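(* Let $(V,E)$ be a finite undirected graph. The two-step nilpotent Lie algebra attached to $(V,E)$, with its nice basis $V\cup\{v\wedge v' : \{v,v'\}\in E\}$, has an arrow-breaking involution.
   Context: The graph is simple (no loops, no multiple edges). Let $V_0$ be the free real vector space generated by $V$ and $V_1\subset\Lambda^2V_0$ the subspace generated by the elements $v\wedge v'$ with $v,v'$ adjacent in $(V,E)$. The Lie algebra attached to $(V,E)$ is $V_0\oplus V_1$, where the nonzero Lie brackets of basis elements are $[v,v']=v\wedge v'$ for adjacent $v,v'\in V$. The basis $\mathcal{B}$ formed by the vertices and by one element $v\wedge v'$ for each edge is a nice basis, i.e. each bracket of two basis elements is a multiple of a single basis element, and each interior product $x\lrcorner d\beta$, with $x\in\mathcal{B}$ and $\beta$ in the dual basis ($d$ the Chevalley--Eilenberg differential), is a multiple of a single dual basis element. The nice diagram is the directed graph with set of nodes $\mathcal{B}$ and labeled arrows, where $x\xrightarrow{y}z$ is an arrow with source $x$, destination $z$ and label $y$ if and only if $[x,y]$ is a nonzero multiple of $z$. An arrow-breaking involution is a permutation $\sigma$ of $\mathcal{B}$ with $\sigma\circ\sigma=\mathrm{id}$ such that: (1) whenever $x$ has an incoming arrow with label $y$, then $\sigma(x)$ does not have an incoming arrow with label $\sigma(y)$; (2) whenever $x$ has an outgoing arrow with label $y$, then $\sigma(x)$ does not have an outgoing arrow with label $\sigma(y)$. *)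

(* Defs.v *)
From HB Require Import structures.
From mathcomp Require Import all_boot all_order all_algebra perm.
From mathcomp Require Import reals.

Set Implicit Arguments.
Unset Strict Implicit.
Unset Printing Implicit Defensive.

Import Order.TTheory GRing.Theory Num.Theory.
Local Open Scope ring_scope.

Record lieAlgebra (R : fieldType) := LieAlgebra {
  lie_sort :> vectType R;
  lie_bracket : lie_sort -> lie_sort -> lie_sort;
  lie_linearl : forall a x x' y,
    lie_bracket (a *: x + x') y = a *: lie_bracket x y + lie_bracket x' y;
  lie_linearr : forall a x y y',
    lie_bracket x (a *: y + y') = a *: lie_bracket x y + lie_bracket x y';
  lie_alternating : forall x, lie_bracket x x = 0;
  lie_jacobi : forall x y z,
    lie_bracket x (lie_bracket y z) + lie_bracket y (lie_bracket z x)
      + lie_bracket z (lie_bracket x y) = 0 }.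

Arguments lie_bracket {R l} x y.

Definition two_step_nilpotent (R : fieldType) (L : lieAlgebra R) : Prop :=
  forall x y z : L, lie_bracket (lie_bracket x y) z = 0.

Section NiceBasis.
Variables (R : fieldType) (L : lieAlgebra R) (I : finType) (b : I -> L).

(* [b] is indexed by a finite type, so that the nodes of the diagram and the
   elements of the basis are in bijection with [I]. *)
Definition is_basis : bool := basis_of fullv (codom b).

Definition dual_basis (i : I) (x : L) : R :=
  coord (codom_tuple b) (enum_rank i) x.

(* (d beta)(x, y) = - beta [x, y] for a 1-form beta *)
Definition CE_differential (beta : L -> R) (x y : L) : R :=
  - beta (lie_bracket x y).

Definition nice_basis : Prop :=
  [/\ is_basis,
      forall i j, exists k, exists c : R,
        lie_bracket (b i) (b j) = c *: b k
    & forall i j, exists k, exists c : R, forall y,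
        CE_differential (dual_basis j) (b i) y = c * dual_basis k y].

(* [nice_diagram x y z]: there is an arrow from x to z with label y *)
Definition nice_diagram (x y z : I) : Prop :=
  exists2 c : R, c != 0 & lie_bracket (b x) (b y) = c *: b z.

End NiceBasis.

Section ArrowBreaking.
Variables (I : finType) (arrow : I -> I -> I -> Prop).

(* in both, [y] is the label of the arrow *)
Definition has_incoming (x y : I) : Prop := exists z, arrow z y x.
Definition has_outgoing (x y : I) : Prop := exists z, arrow x y z.

Definition arrow_breaking_involution (sigma : {perm I}) : Prop :=
  [/\ forall x, sigma (sigma x) = x,
      forall x y, has_incoming x y -> ~ has_incoming (sigma x) (sigma y)
    & forall x y, has_outgoing x y -> ~ has_outgoing (sigma x) (sigma y)].

End ArrowBreaking.

Record simpleGraph := SimpleGraph {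
  vertex :> finType;
  adj : rel vertex;
  adj_sym : symmetric adj;
  adj_irr : irreflexive adj }.

Arguments adj {s} _ _.

Definition is_edge (G : simpleGraph) (e : {set G}) : bool :=
  [exists v, exists w, adj v w && (e == [set v; w])].

Definition edge (G : simpleGraph) : finType := {e : {set G} | is_edge e}.

(* A choice, for every edge {v, v'}, of one of the two elements
   v /\ v' = - (v' /\ v). *)
Definition edge_orientation (G : simpleGraph) (o : edge G -> G * G) : Prop :=
  forall e, sval e = [set (o e).1; (o e).2].

Lemma edge_orientation_exists (G : simpleGraph) :
  exists o : edge G -> G * G, edge_orientation o.
Proof.
apply: (@fin_all_exists _ _ (fun e p => sval e = [set p.1; p.2])) => e.
have /existsP[v /existsP[w /andP[_ /eqP E]]] := svalP e.
by exists (v, w).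
Qed.

Section GraphLieAlgebra.
Variables (R : realType) (G : simpleGraph).

Definition V0 : vectType R := {ffun G -> R^o}.

(* The ambient space of Lambda^2 V_0: x /\ y is realized as the antisymmetric
   tensor x (x) y - y (x) x in V_0 (x) V_0 = R^(G x G). *)
Definition tensor2 : vectType R := {ffun G * G -> R^o}.

Definition vert (v : G) : V0 := [ffun w => (w == v)%:R].

Definition wedge (x y : V0) : tensor2 :=
  [ffun p => x p.1 * y p.2 - x p.2 * y p.1].

Definition V1 : {vspace tensor2} :=
  <<[seq wedge (vert p.1) (vert p.2) | p in [pred p : G * G | adj p.1 p.2]]>>%VS.

Definition graph_space : vectType R := (V0 * subvs_of V1)%type.

(* bilinear extension of [v, v'] = v /\ v' for v, v' adjacent *)
Definition graph_bracket (x y : graph_space) : graph_space :=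
  (0, vsproj V1 (\sum_(p : G * G | adj p.1 p.2)
        (x.1 p.1 * y.1 p.2) *: wedge (vert p.1) (vert p.2))).

Lemma wedge_V1 v w : adj v w -> wedge (vert v) (vert w) \in V1.
Proof.
move=> avw; apply/memv_span/imageP; exists (v, w) => //; rewrite inE.
Qed.

Lemma graph_bracketE x y p q : vsval (graph_bracket x y).2 (p, q) =
  (adj p q)%:R * (x.1 p * y.1 q - x.1 q * y.1 p).
Proof.
rewrite /graph_bracket /= vsprojK; last first.
  by apply: memv_suml => -[v w] /= avw; apply/memvZ/wedge_V1.
rewrite sum_ffunE.
have E (i : G * G) : adj i.1 i.2 ->
   ((x.1 i.1 * y.1 i.2) *: wedge (vert i.1) (vert i.2)) (p, q) =
   (if i == (p, q) then x.1 p * y.1 q else 0)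
   - (if i == (q, p) then x.1 q * y.1 p else 0).
  case: i => v w /= avw; rewrite !ffunE /= !xpair_eqE.
  rewrite /GRing.scale /= mulrBr -!natrM !mulnb.
  rewrite (eq_sym p v) (eq_sym q w) (eq_sym q v) (eq_sym p w).
  by congr (_ - _); case: andP => [[/eqP-> /eqP->]|_]; rewrite ?mulr1 ?mulr0.
rewrite (eq_bigr _ E) sumrB -!big_mkcondr /=.
have [apq|napq] := boolP (adj p q).
  rewrite mul1r (big_pred1 (p, q)) => [|i].
    rewrite (big_pred1 (q, p)) // => i /=.
    by rewrite andbC; case: eqP => // ->; rewrite /= adj_sym apq.
  by rewrite andbC /=; case: eqP => // ->.
rewrite mul0r !big_pred0 ?subr0 // => i; rewrite andbC; case: eqP => // -> /=.
  by rewrite adj_sym (negbTE napq).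
by rewrite (negbTE napq).
Qed.

Lemma graph_space_eq (x y : graph_space) :
  x.1 = y.1 -> (forall p q, vsval x.2 (p, q) = vsval y.2 (p, q)) -> x = y.
Proof.
case: x y => [x1 x2] [y1 y2] /= -> E; congr (_, _); apply: val_inj => /=.
by apply/ffunP => -[p q]; apply: E.
Qed.

Lemma graph_evP a (x y : graph_space) pq :
  vsval (a *: x + y).2 pq = a * vsval x.2 pq + vsval y.2 pq.
Proof.
rewrite [(_ + _).2](_ : _ = a *: x.2 + y.2) // linearP.
by rewrite ffunE; congr (_ + _); rewrite ffunE.
Qed.

Lemma graph_linearl a x x' y : graph_bracket (a *: x + x') y =
  a *: graph_bracket x y + graph_bracket x' y.
Proof.
apply: graph_space_eq => [|p q]; first by rewrite /= scaler0 addr0.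
rewrite graph_evP !graph_bracketE /= !ffunE /GRing.scale /=.
rewrite mulrCA -mulrDr; congr (_ * _).
by rewrite !mulrDl opprD addrACA -!mulrA -mulrN -mulrDr.
Qed.

Lemma graph_alternating x : graph_bracket x x = 0.
Proof.
apply: graph_space_eq => [|p q] //.
by rewrite graph_bracketE [x.1 q * _]mulrC subrr mulr0 linear0 ffunE.
Qed.

Lemma graph_anti x y : graph_bracket x y = - graph_bracket y x.
Proof.
apply: graph_space_eq => [|p q]; first by rewrite /= oppr0.
have := graph_evP (-1) (graph_bracket y x) 0 (p, q).
rewrite scaleN1r addr0 mulN1r linear0 [X in _ + X]ffunE addr0 => ->.
rewrite !graph_bracketE -[RHS]mulrN opprB.
by rewrite (mulrC (y.1 q)) (mulrC (y.1 p)).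
Qed.

Lemma graph_linearr a x y y' : graph_bracket x (a *: y + y') =
  a *: graph_bracket x y + graph_bracket x y'.
Proof.
by rewrite graph_anti graph_linearl opprD -scalerN -!graph_anti.
Qed.

Lemma graph_two_step x y z : graph_bracket (graph_bracket x y) z = 0.
Proof.
apply: graph_space_eq => [|p q] //.
by rewrite graph_bracketE /= !ffunE !mul0r subrr mulr0.
Qed.

Lemma graph_jacobi x y z :
  graph_bracket x (graph_bracket y z) + graph_bracket y (graph_bracket z x)
    + graph_bracket z (graph_bracket x y) = 0.
Proof.
by rewrite 3!(graph_anti _ (graph_bracket _ _)) !graph_two_step oppr0 !addr0.
Qed.

Definition graph_lie : lieAlgebra R :=
  LieAlgebra graph_linearl graph_linearr graph_alternating graph_jacobi.

Lemma graph_lie_two_step_nilpotent : two_step_nilpotent graph_lie.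
Proof. exact: graph_two_step. Qed.

Variable o : edge G -> G * G.

Definition graph_basis (i : G + edge G) : graph_lie :=
  match i with
  | inl v => (vert v, 0)
  | inr e => (0, vsproj V1 (wedge (vert (o e).1) (vert (o e).2)))
  end.

End GraphLieAlgebra.

Section GraphBasisIsNice.
Variables (R : realType) (G : simpleGraph) (o : edge G -> G * G).
Hypothesis ho : edge_orientation o.

Local Notation b := (@graph_basis R G o).

Lemma set2_eq (p q p' q' : G) : [set p; q] = [set p'; q'] ->
  p = p' /\ q = q' \/ p = q' /\ q = p'.
Proof.
move=> E.
have : p \in [set p'; q'] by rewrite -E set21.
have : q \in [set p'; q'] by rewrite -E set22.
have : p' \in [set p; q] by rewrite E set21.
have : q' \in [set p; q] by rewrite E set22.
by rewrite !inE; do 4!move=> /pred2P[] ?; subst; auto.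
Qed.

Lemma orientation_adj e : adj (o e).1 (o e).2.
Proof.
have /existsP[v /existsP[w /andP[avw /eqP]]] := svalP e.
by rewrite ho => /set2_eq[[-> ->]|[-> ->]] //; rewrite adj_sym.
Qed.

Lemma orientation_edge v w : adj v w ->
  exists e, o e = (v, w) \/ o e = (w, v).
Proof.
move=> avw; have ie : is_edge [set v; w].
  by apply/existsP; exists v; apply/existsP; exists w; rewrite avw eqxx.
exists (exist _ [set v; w] ie).
have /= := ho (exist _ [set v; w] ie).
by case: (o _) => p q /= /set2_eq[[-> ->]|[-> ->]]; auto.
Qed.

Lemma orientation_inj e e' :
  o e = o e' \/ o e = ((o e').2, (o e').1) -> e = e'.
Proof.
move=> h; apply: val_inj; apply: etrans (ho e) (etrans _ (esym (ho e'))).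
by case: h => -> //=; rewrite setUC.
Qed.

Lemma graph_basis_edge e p q : vsval (b (inr e)).2 (p, q) =
  ((p, q) == o e)%:R - ((q, p) == o e)%:R.
Proof.
rewrite /= vsprojK ?wedge_V1 ?orientation_adj // !ffunE /= -!natrM !mulnb.
by case: (o e) => v w /=; rewrite !xpair_eqE.
Qed.

Definition graph_coord (i : G + edge G) (x : graph_lie R G) : R :=
  match i with inl v => x.1 v | inr e => vsval x.2 (o e) end.

Lemma graph_coord_linear i : linear (graph_coord i : _ -> R^o).
Proof.
case: i => [v|e] a x y /=; first by rewrite !ffunE.
by rewrite graph_evP.
Qed.

HB.instance Definition _ i :=
  GRing.isLinear.Build R (graph_lie R G) R^o _ (graph_coord i : _ -> R^o)
    (graph_coord_linear i).

Lemma graph_coord_basis i j : graph_coord i (b j) = (i == j)%:R.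
Proof.
case: i j => [v|e] [w|f].
- by rewrite /= ffunE.
- by rewrite /= ffunE.
- by rewrite -[LHS]/(vsval (0 : subvs_of (V1 R G)) (o e)) linear0 ffunE.
rewrite [LHS](_ : _ = vsval (b (inr f)).2 ((o e).1, (o e).2));
  last by rewrite -surjective_pairing.
rewrite graph_basis_edge -surjective_pairing.
rewrite -[inr e == inr f]/(e == f); case: (eqVneq e f) => [->|ef].
  rewrite !eqxx; case: eqP => [|_]; last by rewrite subr0.
  have := orientation_adj f; case: (o f) => p q /= apq [E _].
  by rewrite E adj_irr in apq.
have -> : (o e == o f) = false.
  by apply: contraNF ef => /eqP E; apply/eqP/orientation_inj; left.
case: eqP => [E|]; last by rewrite subrr.
case/eqP: ef; apply: orientation_inj; right.
by rewrite -E /= -surjective_pairing.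
Qed.

Lemma graph_basis_free : free (codom_tuple b).
Proof.
apply/freeP => k sum0 i.
have := congr1 (graph_coord (enum_val i)) sum0.
rewrite linear_sum linear0 (bigD1 i) //= big1 ?addr0 => [|j ji].
  rewrite linearZ /= (nth_map (enum_val i)) -?cardE //.
  rewrite -enum_val_nth graph_coord_basis eqxx.
  by rewrite /GRing.scale /= mulr1.
rewrite linearZ /= (nth_map (enum_val i)) -?cardE // -enum_val_nth.
rewrite graph_coord_basis (inj_eq enum_val_inj) eq_sym (negbTE ji).
by rewrite scaler0.
Qed.

Definition inV1 (a : tensor2 R G) : graph_space R G := (0, vsproj (V1 R G) a).

Lemma inV1_linear : linear inV1.
Proof.
move=> a x y; rewrite /inV1 linearP.
by apply: graph_space_eq; rewrite //= scaler0 addr0.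
Qed.

HB.instance Definition _ :=
  GRing.isLinear.Build R (tensor2 R G) (graph_space R G) _ inV1 inV1_linear.

Lemma graph_basis_span (x : graph_lie R G) : x \in <<codom b>>%VS.
Proof.
have bS i : b i \in <<codom b>>%VS by apply/memv_span/codom_f.
rewrite [x](_ : _ = \sum_v x.1 v *: b (inl v) + linfun inV1 (vsval x.2)).
  apply: memvD; first by apply: memv_suml => v _; apply/memvZ/bS.
  have : (V1 R G <= linfun inV1 @^-1: <<codom b>>)%VS.
    apply/span_subvP => _ /imageP[[v w] /= avw ->].
    rewrite -memv_preim lfunE.
    have [e [oe|oe]] := orientation_edge avw; have := bS (inr e).
      by rewrite /graph_basis oe.
    rewrite -memvN /graph_basis oe /= => bo.
    have -> : wedge (vert R v) (vert R w) = - wedge (vert R w) (vert R v).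
      by apply/ffunP => p; rewrite !ffunE opprB (mulrC (_ == w)%:R)
        [X in _ - X]mulrC.
    by rewrite (linearN inV1).
  by move/subvP/(_ _ (subvsP x.2)); rewrite -memv_preim.
rewrite lfunE /= /inV1 vsvalK.
have -> : \sum_v x.1 v *: b (inl v) =
    ((\sum_v x.1 v *: vert R v, 0) : graph_space R G).
  apply: (big_rec2 (fun p q => p = (q, 0) :> graph_space R G)) => // v q p _ ->.
  by congr (_, _); rewrite /= scaler0 addr0.
rewrite [LHS]surjective_pairing; congr (_, _); rewrite /= ?add0r // addr0.
apply/ffunP => w; rewrite sum_ffunE (bigD1 w) //= big1 => [|v vw].
  by rewrite !ffunE eqxx addr0 /GRing.scale /= mulr1.
by rewrite !ffunE eq_sym (negbTE vw) scaler0.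
Qed.

Lemma graph_basis_is_basis : is_basis b.
Proof.
rewrite /is_basis basisEfree graph_basis_free subvf /=.
rewrite -(eqP graph_basis_free) -(_ : <<codom b>>%VS = fullv) //.
by apply/eqP; rewrite eqEsubv subvf; apply/subvP => x _; apply: graph_basis_span.
Qed.

Lemma graph_dual_basis i x : dual_basis b i x = graph_coord i x.
Proof.
have := coord_span (graph_basis_span x : x \in <<codom_tuple b>>%VS).
move=> /(congr1 (graph_coord i)) ->; rewrite linear_sum /=.
rewrite (bigD1 (enum_rank i)) //= big1 ?addr0 => [|j ji];
  rewrite linearZ /= (nth_map i) -?cardE // -enum_val_nth graph_coord_basis.
  by rewrite enum_rankK eqxx /GRing.scale /= mulr1.
by rewrite -(can_eq (@enum_rankK _)) enum_valK eq_sym (negbTE ji) scaler0.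
Qed.

Lemma graph_bracket0l (x y : graph_lie R G) : x.1 = 0 -> graph_bracket x y = 0.
Proof.
move=> x0; apply: graph_space_eq => [|p q] //.
by rewrite graph_bracketE x0 /= !ffunE !mul0r subrr mulr0.
Qed.

Lemma graph_bracket_vert v w : graph_bracket (b (inl v)) (b (inl w)) =
  if adj v w then inV1 (wedge (vert R v) (vert R w)) else 0.
Proof.
apply: graph_space_eq => [|p q]; first by case: ifP.
have -> : vsval (if adj v w then inV1 (wedge (vert R v) (vert R w))
    else 0).2 (p, q) = (adj v w)%:R * wedge (vert R v) (vert R w) (p, q).
  case: ifP => avw /=; first by rewrite vsprojK ?wedge_V1 // mul1r.
  by rewrite mul0r -[LHS]/(vsval (0 : subvs_of (V1 R G)) (p, q)) linear0 ffunE.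
rewrite graph_bracketE /= !ffunE /= -!natrM !mulnb.
have [/andP[/eqP-> /eqP->]//|_] := boolP ((p == v) && (q == w)).
have [/andP[/eqP-> /eqP->]|_] := boolP ((q == v) && (p == w)).
  by rewrite adj_sym.
by rewrite subrr !mulr0.
Qed.

Lemma graph_basis_is_nice : nice_basis b.
Proof.
split; first exact: graph_basis_is_basis.
  move=> [v|e] j; last first.
    by exists j, 0; rewrite scale0r; apply: graph_bracket0l.
  case: j => [w|e]; last first.
    exists (inr e), 0; rewrite scale0r /= graph_anti graph_bracket0l //.
    exact: oppr0.
  rewrite [lie_bracket _ _]graph_bracket_vert.
  case: ifP => avw; last by exists (inl v), 0; rewrite scale0r.
  have [e [oe|oe]] := orientation_edge avw; exists (inr e).
    by exists 1; rewrite scale1r /= oe.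
  exists (-1); rewrite scaleN1r /= oe -[RHS](linearN inV1) /=; congr inV1.
  by apply/ffunP => p; rewrite !ffunE opprB (mulrC (_ == w)%:R)
    [X in _ - X]mulrC.
move=> i j; rewrite /CE_differential.
have zero : (forall y, graph_coord j (graph_bracket (b i) y) = 0) ->
    exists k, exists c : R, forall y,
      - dual_basis b j (lie_bracket (b i) y) = c * dual_basis b k y.
  move=> z; exists i, 0 => y; rewrite graph_dual_basis [graph_coord _ _]z.
  by rewrite mul0r oppr0.
case: j zero => [w|e] zero; first by apply: zero => y; rewrite /= ffunE.
case: i zero => [v|f] zero; last first.
  by apply: zero => y; rewrite graph_bracket0l //; apply: linear0.
have ev y : graph_coord (inr e) (graph_bracket (b (inl v)) y) =
    ((o e).1 == v)%:R * y.1 (o e).2 - ((o e).2 == v)%:R * y.1 (o e).1.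
  have := graph_bracketE (b (inl v)) y (o e).1 (o e).2.
  by rewrite -surjective_pairing orientation_adj mul1r /= !ffunE.
have ne : (o e).1 != (o e).2.
  by apply: contraTneq (orientation_adj e) => ->; rewrite adj_irr.
have [e1|n1] := eqVneq (o e).1 v.
  exists (inl (o e).2), (-1) => y; rewrite !graph_dual_basis [graph_coord _ _]ev.
  by rewrite -e1 eqxx eq_sym (negbTE ne) /= mul1r mul0r subr0 mulN1r.
have [e2|n2] := eqVneq (o e).2 v; last first.
  by apply: zero => y; rewrite ev (negbTE n1) (negbTE n2) !mul0r subrr.
exists (inl (o e).1), 1 => y; rewrite !graph_dual_basis [graph_coord _ _]ev.
by rewrite -e2 eqxx (negbTE ne) /= mul1r mul0r sub0r opprK.
Qed.

End GraphBasisIsNice.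

(* Main.v *)
Require Import Defs.
From mathcomp Require Import all_boot all_order all_algebra perm.
From mathcomp Require Import reals.

(** An arrow v -w-> e exists only for vertices v, w joined by the edge e. Hence
    every label is a vertex and every node with an incoming arrow is an edge.
    - If there are at least as many edges as vertices, swap the vertices with
      distinct edges and fix the other edges: no vertex is mapped to a vertex.
    - Otherwise choose one endpoint of each edge and enlarge the resulting
      vertex cover to a set A with as many elements as there are edges. Swap A
      with the edges and fix the other vertices: no edge is mapped to an edge,
      and of two adjacent vertices at least one is mapped to an edge. *)

Set Implicit Arguments.
Unset Strict Implicit.
Unset Printing Implicit Defensive.

Import GRing.Theory.
Local Open Scope ring_scope.

Lemma exists_superset_card (T : finType) (C : {set T}) (n : nat) :
  (#|C| <= n <= #|T|)%N -> exists2 A : {set T}, C \subset A & #|A| = n.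
Proof.
elim: n => [|n IHn] /andP[Cn nT].
  by exists C => //; apply/eqP; rewrite -leqn0.
move: Cn; rewrite leq_eqVlt => /predU1P[E|]; first by exists C.
rewrite ltnS => Cn.
have [|A CA cA] := IHn; first by rewrite Cn ltnW.
have /subsetPn[x _ xA] : ~~ ([set: T] \subset A).
  by apply: contraL nT => /subset_leq_card; rewrite cardsT cA -leqNgt.
exists (x |: A); first exact: subset_trans CA (subsetUr _ _).
by rewrite cardsU1 xA cA.
Qed.

(** Enlarge [C] to a set [A] with [#|X|] elements and match the enumerations of [X] and [A]. *)
Lemma exists_injection_covering (X Y : finType) (C : {set Y}) :
  (#|C| <= #|X| <= #|Y|)%N ->
  exists2 f : X -> Y, injective f & C \subset codom f.
Proof.
move=> /exists_superset_card[A CA cA].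
exists (fun x => enum_val (cast_ord (esym cA) (enum_rank x))).
  by move=> x y /enum_val_inj/cast_ord_inj/enum_rank_inj.
apply/subsetP => y /(subsetP CA) yA; apply/codomP.
exists (enum_val (cast_ord cA (enum_rank_in yA y))).
by rewrite enum_valK cast_ordK enum_rankK_in.
Qed.

Lemma exists_swapping_involution (T X : finType) (i j : X -> T) :
  injective i -> injective j -> (forall x y, i x <> j y) ->
  exists s : {perm T}, involutive s /\ forall x, s (i x) = j x.
Proof.
move=> i_inj j_inj ij.
(* The images of [i] and [j] are disjoint, so the order of the two tests is immaterial. *)
pose h t := if [pick x | i x == t] is Some x then j x
            else if [pick x | j x == t] is Some x then i x else t.
have hi x : h (i x) = j x.
  by rewrite /h; case: pickP => [y /eqP/i_inj->|/(_ x)/eqP].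
have hj x : h (j x) = i x.
  rewrite /h; case: pickP => [y /eqP/ij//|_].
  by case: pickP => [y /eqP/j_inj->|/(_ x)/eqP].
have hK : involutive h.
  move=> t; rewrite {2}/h; case: pickP => [x /eqP<-|ni]; first exact: hj.
  case: pickP => [x /eqP<-|nj]; first exact: hi.
  rewrite /h; case: pickP => [x|_]; first by rewrite ni.
  by case: pickP => [x|//]; rewrite nj.
exists (perm (inv_inj hK)); split=> [t|x]; by rewrite !permE ?hK ?hi.
Qed.

Section GraphDiagram.
Variables (R : realType) (G : simpleGraph) (o : edge G -> G * G).
Hypothesis ho : edge_orientation o.

Local Notation arrow := (nice_diagram (graph_basis R o)).

(** Edge elements are central, so source and label are vertices; brackets have no component in [V0],
    so the destination is an edge. *)
Lemma graph_diagram_inv x y z : arrow x y z ->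
  exists v w e, [/\ x = inl v, y = inl w, z = inr e & adj v w].
Proof.
move=> [c c0 E].
have nz : lie_bracket (graph_basis R o x) (graph_basis R o y) <> 0.
  move=> /(congr1 (graph_coord o z)).
  rewrite E linearZ linear0 /= graph_coord_basis // eqxx /GRing.scale /= mulr1.
  exact/eqP.
case: x E nz => [v|e] E nz; last by case: nz; apply: graph_bracket0l.
case: y E nz => [w|e] E nz; last first.
  by case: nz; rewrite /= graph_anti graph_bracket0l ?oppr0.
case: z E => [u|e] E; last first.
  exists v, w, e; split=> //.
  apply: contraPT nz => /negbTE nvw.
  by rewrite [lie_bracket _ _]graph_bracket_vert nvw; apply.
have := congr1 (graph_coord o (inl u)) E.
rewrite linearZ /= !ffunE eqxx /GRing.scale /= mulr1 => /esym/eqP.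
by rewrite (negbTE c0).
Qed.

Lemma graph_diagram_label x y z : arrow x y z -> is_inl y.
Proof. by move=> /graph_diagram_inv[v [w [e [_ -> _ _]]]]. Qed.

(** Both conditions hold because [s] sends every label of an arrow to an edge, which labels no
    arrow. *)
Lemma arrow_breaking_vertices_to_edges (s : {perm (G + edge G)}) :
  involutive s -> (forall v, ~~ is_inl (s (inl v))) ->
  arrow_breaking_involution arrow s.
Proof.
move=> sK sV; split=> // x y [z /graph_diagram_inv[v [w [e [_ -> _ _]]]]];
  by move=> [z' /graph_diagram_label]; rewrite (negbTE (sV w)).
Qed.

(** The hypothesis on edges handles incoming arrows, the one on adjacent vertices outgoing arrows,
    whose source and label are adjacent. *)
Lemma arrow_breaking_edges_to_vertices (s : {perm (G + edge G)}) :
  involutive s -> (forall e, is_inl (s (inr e))) ->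
  (forall v w, adj v w -> ~~ (is_inl (s (inl v)) && is_inl (s (inl w)))) ->
  arrow_breaking_involution arrow s.
Proof.
move=> sK sE sV.
split=> // x y [z /graph_diagram_inv[v [w [e [? ? ? avw]]]]]; subst x y z.
  move=> [z' /graph_diagram_inv[v' [w' [e' [_ _ E _]]]]].
  by have := sE e; rewrite E.
move=> [z' /graph_diagram_inv[v' [w' [e' [Ev Ew _ _]]]]].
by have := sV v w avw; rewrite Ev Ew.
Qed.

End GraphDiagram.

Theorem corollary3p5 (R : realType) (G : simpleGraph) (o : edge G -> G * G)
    (ho : edge_orientation o) :
  exists sigma : {perm (G + edge G)},
    arrow_breaking_involution (nice_diagram (graph_basis R o)) sigma.
Proof.
have [VE|EV] := leqP #|G| #|edge G|.
  have [|f f_inj _] := @exists_injection_covering G (edge G) set0.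
    by rewrite cards0.
  have [||//|s [sK sf]] :=
    @exists_swapping_involution (G + edge G)%type G inl (inr \o f).
  - by move=> ? ? [].
  - by move=> x y [/f_inj].
  exists s; apply: arrow_breaking_vertices_to_edges => // v.
  by rewrite sf.
(* The orientation supplies the chosen endpoint of each edge. *)
pose C := [set (o e).1 | e : edge G].
have [|f f_inj /subsetP Cf] := @exists_injection_covering (edge G) G C.
  by rewrite leq_imset_card ltnW.
have [||//|s [sK sf]] :=
  @exists_swapping_involution (G + edge G)%type (edge G) inr (inl \o f).
- by move=> ? ? [].
- by move=> x y [/f_inj].
(* Each chosen endpoint is some [f e'], which [s] exchanges with the edge [e']. *)
have sC e : ~~ is_inl (s (inl (o e).1)).
  have /codomP[e' ->] : (o e).1 \in codom f by apply/Cf/imset_f.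
  by rewrite -[inl _]/((inl \o f) e') -sf sK.
exists s; apply: arrow_breaking_edges_to_vertices => // [e|v w avw].
  by rewrite sf.
by have [e [oe|oe]] := orientation_edge ho avw; have := sC e;
  rewrite oe => /negbTE->; rewrite ?andbF.
Qed.
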